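(* Let $N\ge 1$, let $G\subseteq\mathcal{S}_N$ be a subgroup of the symmetric group, and let $\chi$ be an irreducible (complex) character of $G$. Let $|G|$ denote the cardinality of $G$ and let $e_\chi\in\mathbb{C}[\mathcal{S}_N]$ be the group ring element $$e_\chi := \frac{\chi(\mathrm{id})}{|G|}\sum_{p\in G}\chi(p)\,p .$$ Then $e_\chi$ is an idempotent, i.e. $e_\chi\cdot e_\chi=e_\chi$, and it satisfies $\overline{e_\chi}^{\ast}=e_\chi$.
   Context: $\mathcal{S}_N$ is the symmetric group of permutations of $\{1,\dots,N\}$ with product $(p\circ q)(i)=p(q(i))$, and $\mathbb{C}[\mathcal{S}_N]$ is its complex group ring. For $a=\sum_p a_p\,p\in\mathbb{C}[\mathcal{S}_N]$ put $\overline{a}:=\sum_p\overline{a_p}\,p$ (complex conjugation of coefficients) and $a^{\ast}:=\sum_p a_p\,p^{-1}$; thus $\overline{a}^{\ast}=\sum_p\overline{a_p}\,p^{-1}$. *)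

(* Defs.v *)
From mathcomp Require Import all_boot all_order all_algebra all_fingroup.
From mathcomp Require Import mxrepresentation.
From mathcomp Require Import complex.
From mathcomp Require Import reals.

Set Implicit Arguments.
Unset Strict Implicit.
Unset Printing Implicit Defensive.

Import GRing.Theory Num.Theory.
Local Open Scope ring_scope.

(* The product (p o q)(i) = p (q i). MathComp composes permutations in the
   opposite order: (p * q)%g i = q (p i). *)
Definition perm_comp (N : nat) (p q : 'S_N) : 'S_N := (q * p)%g.

Lemma perm_compE (N : nat) (p q : 'S_N) (i : 'I_N) :
  perm_comp p q i = p (q i).
Proof. exact: permM. Qed.

(* An element a of C[S_N] is the family of its coefficients a_p. It is wrapped
   in its own name because {ffun 'S_N -> C} already has a canonical product,
   the pointwise one, which is not the product of the group ring. *)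
Definition group_ring (C : Type) (N : nat) := {ffun 'S_N -> C}.

Definition gr_mul (C : pzRingType) (N : nat) (a b : group_ring C N) :
    group_ring C N :=
  [ffun r => \sum_(p : 'S_N) \sum_(q : 'S_N | perm_comp p q == r) a p * b q].

Definition gr_conj (R : rcfType) (N : nat) (a : group_ring R[i] N) :
    group_ring R[i] N :=
  [ffun p => conjc (a p)].

(* The coefficient of p in \sum_q a_q q^-1. *)
Definition gr_star (C : Type) (N : nat) (a : group_ring C N) :
    group_ring C N :=
  [ffun p => a p^-1%g].

(* The character of an irreducible representation of G over the field C; only
   the values of chi on G matter. Matrix representations in MathComp act on row
   vectors from the right and satisfy rG (p * q)%g = rG p *m rG q, so that
   p |-> (rG p)^T is multiplicative for perm_comp and acts on column vectors
   from the left: both have the same stable subspaces and the same trace. *)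
Definition irreducible_character (C : fieldType) (gT : finGroupType)
    (G : {group gT}) (chi : gT -> C) : Prop :=
  exists n : nat, exists rG : mx_representation C G n,
    mx_irreducible rG /\ {in G, forall p, chi p = \tr (rG p)}.

Definition char_idem (C : fieldType) (N : nat) (G : {group 'S_N}) (chi : 'S_N -> C) :
    group_ring C N :=
  [ffun p => if p \in G then chi 1%g / #|G|%:R * chi p else 0].

(* Main.v *)
Require Import Defs.
From mathcomp Require Import all_boot all_order all_algebra all_fingroup.
From mathcomp Require Import mxrepresentation.
From mathcomp Require Import complex.
From mathcomp Require Import reals.

Set Implicit Arguments.
Unset Strict Implicit.
Unset Printing Implicit Defensive.

Import GRing.Theory Num.Theory.
Local Open Scope ring_scope.
Local Open Scope complex_scope.

(** Coefficientwise, the two claims are the identities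
    [\sum_(p in G) chi(p) chi(r p^-1) = |G| / chi(1) * chi(r)] for [r \in G],
    and [chi(p^-1) = (chi p)^*] for [p \in G].

    The first one is Schur orthogonality. If [rG] affords [chi] in dimension
    [n], then for every matrix [A] the average of the conjugates
    [rG x *m A *m rG x^-1] commutes with [rG], hence is scalar, because an
    irreducible representation over an algebraically closed field is absolutely
    irreducible; comparing traces gives the scalar ([repr_sum_conj]). Taking
    the elementary matrices for [A] and summing the resulting relations between
    matrix entries yields [\sum_x chi(x) rG x^-1 = |G| / n] as a scalar matrix
    ([repr_sum_char]). It remains to multiply by [rG r] and take the trace
    ([irr_char_convolution]).

    The second one is the unitary trick: [rG] preserves a positive definite
    Hermitian form, obtained by averaging the standard one, so that [rG x^-1]
    is similar to the conjugate transpose of [rG x] ([repr_trace_inv]). *)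

Section Schur.

Variables (C : closedFieldType) (gT : finGroupType) (G : {group gT}).
Variables (n : nat) (rG : mx_representation C G n).
Hypothesis irrG : mx_irreducible rG.
Hypothesis n_neq0 : n%:R != 0 :> C.

(** Averaging makes [A] commute with [rG]; by Schur's lemma the result is
    scalar, and since each conjugate has the trace of [A], the scalar is forced
    as soon as [n] is invertible. *)
Lemma repr_sum_conj (A : 'M[C]_n) :
  \sum_(x in G) rG x *m A *m rG x^-1%g = (#|G|%:R / n%:R * \tr A)%:M.
Proof.
set S := \sum_(x in G) _.
have cS : centgmx rG S.
  apply/centgmxP => y Gy.
  rewrite /S mulmx_suml mulmx_sumr [RHS](reindex_inj (mulgI y^-1%g)) /=.
  apply: eq_big => [x|x Gx]; first by rewrite groupMl ?groupV.
  rewrite invMg invgK [rG (x^-1 * y)%g]repr_mxM ?groupV // !mulmxA.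
  by rewrite -repr_mxM ?groupM ?groupV // mulKVg.
have absG : mx_absolutely_irreducible rG by exact: group_closure_closed_field.
have /is_scalar_mxP[a Sa] := mx_abs_irr_cent_scalar absG cS.
have trS : \tr S = #|G|%:R * \tr A.
  rewrite /S raddf_sum mulr_natl -sumr_const; apply: eq_bigr => x Gx /=.
  by rewrite mxtrace_mulC mulmxA -repr_mxM ?groupV // mulVg repr_mx1 mul1mx.
by rewrite Sa mulrAC -trS Sa mxtrace_scalar -[a *+ n]mulr_natr mulfK.
Qed.

(** For [A = delta_mx i k] the previous sum has
    [\sum_x (rG x) i i * (rG x^-1) k l] as its [(i, l)] entry, so summing this
    entry over [i] brings in the trace of [rG x]. *)
Lemma repr_sum_char :
  \sum_(x in G) \tr (rG x) *: rG x^-1%g = (#|G|%:R / n%:R)%:M.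
Proof.
apply/matrixP => k l; rewrite summxE.
under eq_bigr do rewrite mxE mulr_suml.
rewrite exchange_big /=.
have entry (i : 'I_n) : \sum_(x in G) rG x i i * rG x^-1%g k l =
    (#|G|%:R / n%:R) * (i == k)%:R * (i == l)%:R.
  have /matrixP/(_ i l) := repr_sum_conj (delta_mx i k).
  have -> : \tr (delta_mx i k : 'M[C]_n) = (i == k)%:R.
    rewrite /mxtrace (bigD1 i) //= big1 ?addr0 ?mxE ?eqxx // => j ij.
    by rewrite mxE (negPf ij).
  rewrite summxE mxE mulr_natr => <-.
  apply: eq_bigr => x Gx; rewrite -mulmxA mxE (bigD1 i) //= big1 ?addr0.
    rewrite mxE (bigD1 k) //= big1 ?addr0 ?mxE ?eqxx ?mul1r // => j kj.
    by rewrite mxE (negPf kj) andbF mul0r.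
  move=> j ij; rewrite [X in _ * X]mxE big1 ?mulr0 // => h _.
  by rewrite mxE (negPf ij) mul0r.
rewrite (eq_bigr _ (fun i _ => entry i)) (bigD1 k) //= big1 ?addr0.
  by rewrite eqxx mulr1 mxE mulr_natr.
by move=> i ik; rewrite (negPf ik) mulr0 mul0r.
Qed.

Lemma irr_char_convolution r : r \in G ->
  \sum_(x in G) \tr (rG x) * \tr (rG (r * x^-1)%g) =
  #|G|%:R / n%:R * \tr (rG r).
Proof.
move=> Gr.
rewrite -mxtraceZ -mul_mx_scalar -repr_sum_char mulmx_sumr raddf_sum /=.
apply: eq_bigr => x Gx.
by rewrite -scalemxAr mxtraceZ repr_mxM ?groupV.
Qed.

End Schur.

(** The Gram matrix [H = \sum_y rG y *m (rG y)^*] of the averaged Hermitian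
    form satisfies [rG x *m H *m (rG x)^* = H] and is invertible, as [v *m H = 0]
    makes the sum of the square norms of the rows [v *m rG y] vanish. *)
Lemma repr_trace_inv (C : numClosedFieldType) (gT : finGroupType)
    (G : {group gT}) (n : nat) (rG : mx_representation C G n) :
  {in G, forall x, \tr (rG x^-1%g) = (\tr (rG x))^*%R}.
Proof.
pose adj m1 m2 (A : 'M[C]_(m1, m2)) := (map_mx Num.conj A)^T.
have adjM m1 m2 m3 (A : 'M_(m1, m2)) (B : 'M_(m2, m3)) :
    adj _ _ (A *m B) = adj _ _ B *m adj _ _ A.
  by rewrite /adj map_mxM trmx_mul.
pose H : 'M_n := \sum_(y in G) rG y *m adj _ _ (rG y).
have H_unit : H \in unitmx.
  rewrite -row_free_unit; apply/inj_row_free => v vH0.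
  have w_norm (w : 'rV[C]_n) : (w *m adj _ _ w) 0 0 = \sum_j `|w 0 j| ^+ 2.
    by rewrite mxE; apply: eq_bigr => j _; rewrite !mxE normCK.
  have : (v *m H *m adj _ _ v) 0 0 = 0 by rewrite vH0 mul0mx mxE.
  rewrite mulmx_sumr mulmx_suml summxE.
  under eq_bigr => y _ do rewrite mulmxA -mulmxA -adjM w_norm.
  have row_ge0 (w : 'rV[C]_n) : 0 <= \sum_j `|w 0 j| ^+ 2.
    by apply: sumr_ge0 => j _; rewrite exprn_ge0.
  move/psumr_eq0P => /(_ (fun y _ => row_ge0 _) 1%g (group1 G)).
  rewrite repr_mx1 mulmx1 => /psumr_eq0P v0.
  apply/rowP => j; rewrite mxE; apply/eqP.
  rewrite -normr_eq0 -sqrf_eq0; apply/eqP; apply: v0 => // i _.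
  by rewrite exprn_ge0.
move=> x Gx.
have inv_H : rG x *m H *m adj _ _ (rG x) = H.
  rewrite mulmx_sumr mulmx_suml [RHS](reindex_inj (mulgI x)) /=.
  apply: eq_big => [y|y Gy]; first by rewrite groupMl.
  by rewrite repr_mxM // adjM !mulmxA.
have H_adj : H *m adj _ _ (rG x) = rG x^-1%g *m H.
  by rewrite -{2}inv_H !mulmxA -repr_mxM ?groupV // mulVg repr_mx1 mul1mx.
have -> : rG x^-1%g = H *m adj _ _ (rG x) *m invmx H by rewrite H_adj mulmxK.
by rewrite mxtrace_mulC mulKmx // mxtrace_tr trace_map_mx.
Qed.

Theorem theorem2p6 (R : realType) (N : nat) (hN : (0 < N)%N)
    (G : {group 'S_N}) (chi : 'S_N -> R[i])
    (hchi : irreducible_character G chi) :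
  gr_mul (char_idem G chi) (char_idem G chi) = char_idem G chi /\
  gr_star (gr_conj (char_idem G chi)) = char_idem G chi.
Proof.
have [n [rG [irrG chiE]]] := hchi.
have n_neq0 : n%:R != 0 :> R[i].
  by rewrite pnatr_eq0 -lt0n; have [] := (mx_irrP rG).1 irrG.
have G_neq0 : #|G|%:R != 0 :> R[i] by rewrite pnatr_eq0 -lt0n cardG_gt0.
have chi1 : chi 1%g = n%:R by rewrite chiE // repr_mx1 mxtrace1.
split; apply/ffunP => r; rewrite !ffunE.
- pose c : R[i] := n%:R / #|G|%:R.
  have coefE q : char_idem G chi q = if q \in G then c * \tr (rG q) else 0.
    by rewrite ffunE; case: ifP => // Gq; rewrite chi1 chiE.
  transitivity (\sum_(p in G) char_idem G chi p * char_idem G chi (r * p^-1)%g).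
    rewrite [RHS]big_mkcond; apply: eq_bigr => p _.
    rewrite (big_pred1 (r * p^-1)%g) => [|q].
      by rewrite [char_idem G chi p]coefE; case: ifP; rewrite ?mul0r.
    by rewrite /perm_comp -(inj_eq (mulIg p^-1%g)) mulgK.
  have [Gr|nGr] := boolP (r \in G); last first.
    apply: big1 => p Gp.
    by rewrite [char_idem G chi (r * _)%g]coefE groupMr ?groupV // (negPf nGr) mulr0.
  transitivity (c * c * (\sum_(p in G) \tr (rG p) * \tr (rG (r * p^-1)%g))).
    rewrite mulr_sumr; apply: eq_bigr => p Gp.
    by rewrite !coefE Gp groupM ?groupV // mulrACA.
  rewrite irr_char_convolution // chi1 chiE // /c !mulrA.
  by rewrite divfK // mulfK.
- rewrite groupV; case: ifP => [Gr|_]; last exact: conjc0.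
  rewrite chi1 chiE ?groupV // repr_trace_inv // -chiE //.
  (* [conjc] is, up to conversion, the conjugation of the closed field [R[i]]. *)
  transitivity (Num.conj (n%:R / #|G|%:R * Num.conj (chi r))) => //.
  by rewrite rmorphM fmorph_div !rmorph_nat; congr (_ * _); exact: conjCK.
Qed.
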